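(* Let $X,Y$ be nonempty finite sets and let $\theta_X$, $\theta_Y$ be formigrams over $X$ and $Y$ respectively, with bounded supports and critical points in $\mathbb{Z}$. Then $$d_{\mathrm E}\big(|\Diamond\theta_X|,|\Diamond\theta_Y|\big)\le d_{\mathrm I}^{\mathrm F}(\theta_X,\theta_Y).$$
   Context: Subpartitions. A subpartition of $X$ is a partition $P$ of a (possibly empty) subset of $X$; its elements are blocks, $\bigcup P$ is its underlying set and $|P|$ is its number of blocks. $\mathrm{SubPart}(X)$ is the lattice of all subpartitions of $X$, ordered by $P\le Q$ iff every block of $P$ is contained in some block of $Q$; $\vee$ is the finest common coarsening and $\wedge$ the coarsest common refinement. Formigrams. A formigram over $X$ is a map $\theta_X:\mathbb{R}\to\mathrm{SubPart}(X)$ such that (a) there is a locally finite set $C\subset\mathbb{R}$ of critical points such that $\theta_X$ is constant on each connected component of $\mathbb{R}\setminus C$ and for every $c\in C$ there is $r_c>0$ with $\theta_X(c-\varepsilon)\le\theta_X(c)\ge\theta_X(c+\varepsilon)$ for all $\varepsilon\in[0,r_c)$; (b) for each $x\in X$ there is a (nonempty) closed interval $I_x\subset\mathbb{R}$ with $x\in\bigcup\theta_X(t)$ iff $t\in I_x$. The support is $\bigcup_xI_x$; ''critical points in $\mathbb{Z}$'' means $C\subset\mathbb{Z}$ can be chosen. $\mathbf{Int}$ is the poset of nonempty bounded closed real intervals ordered by inclusion; $I^\varepsilon=[b-\varepsilon,d+\varepsilon]$ for $I=[b,d]$, $\varepsilon\geq0$. $\bigvee_I\theta_X=\bigvee\{\theta_X(t):t\in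 I\}$, $\bigwedge_I\theta_X=\bigwedge\{\theta_X(t):t\in I\}$. With $X'=\bigcup\big(\bigwedge_I\theta_X\big)$, let $\Diamond_I\theta_X=\{B\cap X':B\in\bigvee_I\theta_X,\ B\cap X'\ne\emptyset\}$. The persistent cluster counting functor $|\Diamond\theta_X|:\mathbf{Int}\to\mathbb{Z}_+$ (nonnegative integers) is $I\mapsto|\Diamond_I\theta_X|$; it is order-reversing. Erosion distance. For order-reversing $Y_1,Y_2:\mathbf{Int}\to\mathbb{Z}_+$, $d_{\mathrm E}(Y_1,Y_2)=\inf\{\varepsilon\in[0,\infty):\ \forall I\in\mathbf{Int},\ Y_1(I^\varepsilon)\le Y_2(I)\text{ and }Y_2(I^\varepsilon)\le Y_1(I)\}$. Formigram distance. A tripod $R$ between $X$ and $Y$ is a set $Z$ with surjections $\varphi_X:Z\to X$, $\varphi_Y:Z\to Y$. For a surjection $\varphi:Z\to X$, $(\varphi^*\theta_X)(t)=\{\varphi^{-1}(B):B\in\theta_X(t)\}$. For formigrams $\theta,\theta'$ over $Z$, $d_{\mathrm I}^{\mathrm{SubPart}(Z)}(\theta,\theta')=\inf\{\varepsilon\ge0:\ \forall I\in\mathbf{Int},\ \bigvee_I\theta\le\bigvee_{I^\varepsilon}\theta'\text{ and }\bigvee_I\theta'\le\bigvee_{I^\varepsilon}\theta\}$. $R$ is an $\varepsilon$-tripod if $d_{\mathrm I}^{\mathrm{SubPart}(Z)}(\varphi_X^*\theta_X,\varphi_Y^*\theta_Y)\le\varepsilon$. $d_{\mathrm I}^{\mathrm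 F}(\theta_X,\theta_Y)$ is the minimum (infimum) of $\varepsilon\ge0$ for which an $\varepsilon$-tripod exists ($+\infty$ if none). *)

(* Defs.v *)
From HB Require Import structures.
From mathcomp Require Import all_boot all_order all_algebra finmap.
From mathcomp Require Import all_classical all_reals all_analysis.

Set Implicit Arguments.
Unset Strict Implicit.
Unset Printing Implicit Defensive.

Import Order.TTheory GRing.Theory Num.Theory.
Import numFieldNormedType.Exports.

Local Open Scope classical_set_scope.
Local Open Scope ring_scope.

(* [T] is an arbitrary type: the apex of a tripod need not be finite. *)
Record subpart (T : Type) := Subpart {
  blocks :> set (set T);
  blocks_partition : partition blocks id (cover blocks id) }.

Definition underlying (T : Type) (P : subpart T) : set T := cover (blocks P) id.

Lemma subpart_eq (T : Type) (P Q : subpart T) : blocks P = blocks Q -> P = Q.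
Proof.
case: P Q => [P hP] [Q hQ] /= PQ; subst Q.
by congr Subpart; exact: Prop_irrelevance.
Qed.

Lemma block_neq0 (T : Type) (P : subpart T) B : blocks P B -> B !=set0.
Proof. by case: P => P [? ? h]; exact: h. Qed.

Lemma block_inj (T : Type) (P : subpart T) B C x :
  blocks P B -> blocks P C -> B x -> C x -> B = C.
Proof. by case: P => P [? h ?] /= PB PC Bx Cx; apply: h => //; exists x. Qed.

HB.instance Definition _ (T : Type) := gen_eqMixin (subpart T).
HB.instance Definition _ (T : Type) := gen_choiceMixin (subpart T).

Definition subpart_le (T : Type) (P Q : subpart T) : bool :=
  `[< forall B, blocks P B -> exists2 C, blocks Q C & B `<=` C >].

Lemma subpart_le_refl (T : Type) : reflexive (@subpart_le T).
Proof. by move=> P; apply/asboolP => B PB; exists B. Qed.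

Lemma subpart_le_anti (T : Type) : antisymmetric (@subpart_le T).
Proof.
have H (P Q : subpart T) : subpart_le P Q -> subpart_le Q P ->
    blocks P `<=` blocks Q.
  move=> /asboolP PQ /asboolP QP B PB.
  have [C QC BC] := PQ _ PB; have [D PD CD] := QP _ QC.
  have [x Bx] := block_neq0 PB.
  have BD : B = D by apply: (block_inj PB PD Bx); exact/CD/BC.
  by have -> : B = C by apply/seteqP; split => //; rewrite BD.
move=> P Q /andP[PQ QP]; apply: subpart_eq.
by apply/seteqP; split; exact: H.
Qed.

Lemma subpart_le_trans (T : Type) : transitive (@subpart_le T).
Proof.
move=> Q P S /asboolP PQ /asboolP QS; apply/asboolP => B /PQ[C /QS[D SD CD] BC].
by exists D => //; exact: subset_trans CD.
Qed.

Fact subpart_display : Order.disp_t. Proof. by []. Qed.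

HB.instance Definition _ (T : Type) :=
  Order.Le_isPOrder.Build subpart_display (subpart T)
    (@subpart_le_refl T) (@subpart_le_anti T) (@subpart_le_trans T).

Lemma subpart_leP (T : Type) (P Q : subpart T) :
  reflect (forall B, blocks P B -> exists2 C, blocks Q C & B `<=` C)
          (P <= Q)%O.
Proof. exact: asboolP. Qed.

Fact subpart_bot_partition (T : Type) :
  partition (set0 : set (set T)) id (cover set0 id).
Proof. by split => // B C []. Qed.

Definition subpart_bot (T : Type) : subpart T :=
  Subpart (@subpart_bot_partition T).

Fact subpart_top_partition (T : Type) (D := [set B : set T | B = setT /\ B !=set0]) :
  partition D id (cover D id).
Proof. by split => // [B C [-> _] [-> _]|B []]. Qed.

Definition subpart_top (T : Type) : subpart T :=
  Subpart (@subpart_top_partition T).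

Lemma subpart_le_top (T : Type) (P : subpart T) : (P <= subpart_top T)%O.
Proof.
apply/subpart_leP => B PB; exists setT => //; split => //.
by have [x _] := block_neq0 PB; exists x.
Qed.

(* The default values only matter for the empty family. *)
Definition subpart_join (T : Type) (F : set (subpart T)) : subpart T :=
  supremum (subpart_bot T) F.

Definition subpart_meet (T : Type) (F : set (subpart T)) : subpart T :=
  infimum (subpart_top T) F.

(* [supremum] and [infimum] are genuine bounds because [subpart T] is a
   complete lattice. *)
Definition meet_class (T : Type) (F : set (subpart T)) (x : T) : set T :=
  [set y | forall P, F P -> exists B, [/\ blocks P B, B x & B y]].

Definition meet_blocks (T : Type) (F : set (subpart T)) : set (set T) :=
  [set B | exists2 x, meet_class F x x & B = meet_class F x].

Lemma meet_class_eq (T : Type) (F : set (subpart T)) x y :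
  meet_class F x y -> meet_class F x = meet_class F y.
Proof.
move=> xy; apply/seteqP; split => z h P FP.
  have [B [PB Bx By]] := xy _ FP; have [C [PC Cx Cz]] := h _ FP.
  by exists B; split => //; rewrite (block_inj PB PC Bx Cx).
have [B [PB Bx By]] := xy _ FP; have [C [PC Cy Cz]] := h _ FP.
by exists B; split => //; rewrite (block_inj PB PC By Cy).
Qed.

Fact meet_partition (T : Type) (F : set (subpart T)) :
  partition (meet_blocks F) id (cover (meet_blocks F) id).
Proof.
split => //.
  move=> B C [x xx ->] [y yy ->] [z [/= xz yz]].
  by rewrite (meet_class_eq xz) (meet_class_eq yz).
by move=> B [x xx ->]; exists x.
Qed.

Lemma subpart_infimums (T : Type) (F : set (subpart T)) :
  F !=set0 -> infimums F (Subpart (meet_partition F)).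
Proof.
move=> [P0 FP0]; split.
  move=> P FP; apply/subpart_leP => _ [x xx ->].
  have [B [PB Bx _]] := xx _ FP; exists B => // y xy.
  have [C [PC Cx Cy]] := xy _ FP.
  by rewrite (block_inj PB PC Bx Cx).
move=> Q lQ; apply/subpart_leP => B QB.
have BF y z : B y -> B z -> meet_class F y z.
  move=> By Bz P FP; have /subpart_leP/(_ _ QB)[C PC BC] := lQ _ FP.
  by exists C; split => //; exact: BC.
have [x Bx] := block_neq0 QB.
by exists (meet_class F x) => [|y By]; [exists x => //|]; exact: BF.
Qed.

Lemma subpart_meetP (T : Type) (F : set (subpart T)) :
  F !=set0 -> infimums F (subpart_meet F).
Proof.
move=> F0; rewrite /subpart_meet /infimum ifF; last exact/negbTE/set0P.
by apply: xgetPex; exists (Subpart (meet_partition F)); exact: subpart_infimums.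
Qed.

Lemma subpart_joinP (T : Type) (F : set (subpart T)) :
  F !=set0 -> supremums F (subpart_join F).
Proof.
move=> F0; rewrite /subpart_join /supremum ifF; last exact/negbTE/set0P.
apply: xgetPex.
have [] := @subpart_infimums T (ubound F).
  by exists (subpart_top T) => P _; exact: subpart_le_top.
move=> lU gU; eexists; split; last exact: lU.
by move=> P FP; apply: gU => Q; apply.
Qed.

Record cint (R : realType) := Cint {
  lo : R;
  hi : R;
  lo_le_hi : lo <= hi }.

Definition cint_set (R : realType) (I : cint R) : set R := `[lo I, hi I].

Coercion cint_set : cint >-> set.

Fact thicken_subproof (R : realType) (I : cint R) (e : {nonneg R}) :
  lo I - e%:num <= hi I + e%:num.
Proof.
by rewrite lerD ?lo_le_hi// (le_trans _ (ge0 e))// oppr_le0.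
Qed.

Definition thicken (R : realType) (I : cint R) (e : {nonneg R}) : cint R :=
  Cint (thicken_subproof I e).

Section Formigram.
Context {R : realType} {X : Type}.
Implicit Types (theta : R -> subpart X) (I : cint R).

Definition locally_finite (C : set R) : Prop :=
  forall t : R, exists2 U, nbhs t U & finite_set (C `&` U).

Definition critical_points theta (C : set R) : Prop :=
  [/\ locally_finite C,
      forall s t, connected_component (~` C) s t -> theta s = theta t &
      forall c, C c -> exists2 r : R, 0 < r &
        forall e, 0 <= e < r ->
          (theta (c - e) <= theta c)%O /\ (theta (c + e) <= theta c)%O].

Definition lifespan theta (x : X) : set R := [set t | underlying (theta t) x].

Definition is_formigram theta : Prop :=
  (exists C, critical_points theta C) /\
  (forall x, [/\ lifespan theta x !=set0, is_interval (lifespan theta x) &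
                 closed (lifespan theta x)]).

Definition fg_support theta : set R := \bigcup_(x in [set: X]) lifespan theta x.

Definition integer_critical_points theta : Prop :=
  exists2 C, critical_points theta C & C `<=` range (fun n : int => n%:~R : R).

Definition join_over I theta : subpart X := subpart_join (theta @` I).

Definition meet_over I theta : subpart X := subpart_meet (theta @` I).

Definition diamond I theta : set (set X) :=
  let X' := underlying (meet_over I theta) in
  [set B `&` X' | B in
    [set B : set X | blocks (join_over I theta) B /\ B `&` X' !=set0]].

(* [fset_set] is the identity on finite sets of blocks, hence whenever [X] is
   finite; on infinite ones the value is the junk value 0. *)
Definition cluster_count theta : cint R -> nat :=
  fun I => #|` fset_set (diamond I theta)|.

Definition interleaving_dist (theta1 theta2 : R -> subpart X) : \bar R :=
  ereal_inf [set e%:num%:E | e in [set e : {nonneg R} |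
    forall I, (join_over I theta1 <= join_over (thicken I e) theta2)%O /\
              (join_over I theta2 <= join_over (thicken I e) theta1)%O]].

End Formigram.

Lemma subpart_le_underlying (T : Type) (P Q : subpart T) :
  (P <= Q)%O -> underlying P `<=` underlying Q.
Proof. by move=> /subpart_leP PQ x [B /PQ[C QC BC] /BC Cx]; exists C. Qed.

Lemma le_join_over (R : realType) (X : Type) (theta : R -> subpart X)
    (I : cint R) t : (I : set R) t -> (theta t <= join_over I theta)%O.
Proof.
move=> It; have Ft : (theta @` I) (theta t) by exists t.
by apply: (subpart_joinP _).1 => //; exists (theta t).
Qed.

Lemma ge_meet_over (R : realType) (X : Type) (theta : R -> subpart X)
    (I : cint R) t : (I : set R) t -> (meet_over I theta <= theta t)%O.
Proof.
move=> It; have Ft : (theta @` I) (theta t) by exists t.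
by apply: (subpart_meetP _).1 => //; exists (theta t).
Qed.

Lemma cint_lo (R : realType) (I : cint R) : (I : set R) (lo I).
Proof. by rewrite /cint_set /= in_itv/= lexx lo_le_hi. Qed.

Lemma cluster_count_anti (R : realType) (X : finType) (theta : R -> subpart X)
    (I J : cint R) :
  (J : set R) `<=` I -> (cluster_count theta I <= cluster_count theta J)%N.
Proof.
move=> JI.
have joinJI : (join_over J theta <= join_over I theta)%O.
  apply: (subpart_joinP _).2.
    by exists (theta (lo J)); exists (lo J) => //; exact: cint_lo.
  by move=> _ [t Jt <-]; exact/le_join_over/JI.
have meetIJ : (meet_over I theta <= meet_over J theta)%O.
  apply: (subpart_meetP _).2.
    by exists (theta (lo J)); exists (lo J) => //; exact: cint_lo.
  by move=> _ [t Jt <-]; exact/ge_meet_over/JI.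
have finD K : finite_set (diamond K theta).
  apply: (@sub_finite_set _ _ (range (fun A : {set X} => [set` A]))).
    move=> A _; exists (finset (fun x => `[< A x >])) => //.
    by apply/seteqP; split => x /=; rewrite inE => /asboolP.
  exact/finite_image/finite_finset.
pose f (A : set X) : set X := underlying (meet_over I theta) `&`
    \bigcup_(C in [set C | blocks (join_over I theta) C /\ C `&` A !=set0]) C.
  have /fsubset_leq_card le1 : (fset_set (diamond I theta) `<=`
    [fset f A | A in fset_set (diamond J theta)])%fset.
  apply/fsubsetP => D; rewrite in_fset_set// inE => -[C [CI [x [Cx mx]]] CD].
  have mJx := subpart_le_underlying meetIJ mx.
  have [B BJ Bx] : underlying (join_over J theta) x.
    apply: subpart_le_underlying mJx.
    exact: le_trans (ge_meet_over _ (cint_lo J)) (le_join_over _ (cint_lo J)).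
  have BC : B `<=` C.
    have /subpart_leP/(_ _ BJ)[C' C'I BC'] := joinJI.
    by rewrite (block_inj CI C'I Cx) //; exact: BC'.
  apply/imfsetP; exists (B `&` underlying (meet_over J theta)) => /=.
    by rewrite in_fset_set// inE; exists B => //; split => //; exists x.
  rewrite -CD; apply/seteqP; split => [y [Cy my]|y [my [C' [C'I [z [C'z [Bz _]]] C'y]]]].
    by split => //; exists C => //; split => //; exists x.
  by split => //; rewrite (block_inj CI C'I (BC _ Bz) C'z).
by rewrite /cluster_count (leq_trans le1)// leq_imfset_card.
Qed.

Definition erosion_dist (R : realType) (Y1 Y2 : cint R -> nat) : \bar R :=
  ereal_inf [set e%:num%:E | e in [set e : {nonneg R} |
    forall I, (Y1 (thicken I e) <= Y2 I)%N /\ (Y2 (thicken I e) <= Y1 I)%N]].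

Fact pullback_partition (Z X : Type) (phi : {surj [set: Z] >-> [set: X]})
    (P : subpart X) (D := [set phi @^-1` B | B in blocks P]) :
  partition D id (cover D id).
Proof.
split => //.
  move=> _ _ [B PB <-] [C PC <-] [z [Bz Cz]].
  by rewrite (block_inj PB PC Bz Cz).
move=> _ [B /block_neq0[x Bx] <-].
have [z _ zx] : (phi @` setT) x by exact: surj.
by exists z; rewrite /preimage/= zx.
Qed.

Definition pullback_subpart (Z X : Type) (phi : {surj [set: Z] >-> [set: X]})
    (P : subpart X) : subpart Z := Subpart (pullback_partition phi P).

Definition pullback (R : realType) (Z X : Type)
    (phi : {surj [set: Z] >-> [set: X]}) (theta : R -> subpart X) :
  R -> subpart Z := fun t => pullback_subpart phi (theta t).

Record tripod (X Y : Type) := Tripod {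
  apex : Type;
  legl : {surj [set: apex] >-> [set: X]};
  legr : {surj [set: apex] >-> [set: Y]} }.

Definition is_eps_tripod (R : realType) (X Y : Type) (thetaX : R -> subpart X)
    (thetaY : R -> subpart Y) (T : tripod X Y) (e : {nonneg R}) : Prop :=
  (interleaving_dist (pullback (legl T) thetaX) (pullback (legr T) thetaY)
     <= e%:num%:E)%E.

Definition formigram_dist (R : realType) (X Y : Type)
    (thetaX : R -> subpart X) (thetaY : R -> subpart Y) : \bar R :=
  ereal_inf [set e%:num%:E | e in [set e : {nonneg R} |
    exists T : tripod X Y, is_eps_tripod thetaX thetaY T e]].

(* Main.v *)
(** An interleaving of the pullbacks to the apex of a tripod bounds the erosion
    distance. A point [x] alive throughout [I^e] is tied by the tripod to points
    [y]; the interleaving at the two end points [a - e] and [b + e] of [I^e]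
    shows that [y] is alive somewhere in [[a - 2e, a]] and somewhere in
    [[b, b + 2e]], hence throughout [I = [a, b]], its lifespan being an interval.
    As pullback commutes with joins, the block of [y] in the join over [I]
    determines the block of [x] in the join over [I^e], so the clusters of the
    first formigram over [I^e] inject into those of the second over [I]. *)

Require Import Defs.
From mathcomp Require Import all_boot all_order all_algebra.
From mathcomp Require Import finmap.
From mathcomp Require Import all_classical all_reals all_analysis.
Import numFieldNormedType.Exports.

Set Implicit Arguments.
Unset Strict Implicit.
Unset Printing Implicit Defensive.

Import Order.TTheory GRing.Theory Num.Theory.

Local Open Scope classical_set_scope.
Local Open Scope ring_scope.

Lemma finite_set_of_sets (X : finType) (A : set (set X)) : finite_set A.
Proof.
apply: (@sub_finite_set _ _ (range (fun B : {set X} => [set` B]))).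
  move=> B _; exists (finset (fun x => `[< B x >])) => //.
  by apply/seteqP; split => x /=; rewrite inE => /asboolP.
exact/finite_image/finite_finset.
Qed.

(** Choosing for each [b] one [a] related to it covers [A], since [b] determines [a]. A relation is
    used because one cluster may be tied to several others through the tripod. *)
Lemma card_fset_set_rel_le (S T : choiceType) (A : set S) (B : set T)
    (r : S -> T -> Prop) :
  finite_set A -> finite_set B ->
  (forall a, A a -> exists2 b, B b & r a b) ->
  (forall a a' b, A a -> A a' -> B b -> r a b -> r a' b -> a = a') ->
  (#|` fset_set A| <= #|` fset_set B|)%N.
Proof.
move=> finA finB rAB rinj.
have [->|/set0P[a0 Aa0]] := eqVneq A set0; first by rewrite fset_set0 cardfs0.
(* The default [a0] is taken at a [b] related to nothing in [A]; this is harmless, as the image of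
   [f] only has to cover [A]. *)
pose f b := xget a0 [set a | A a /\ r a b].
have /fsubset_leq_card le1 :
    (fset_set A `<=` [fset f b | b in fset_set B])%fset.
  apply/fsubsetP => a; rewrite in_fset_set// inE => Aa.
  have [b Bb rab] := rAB _ Aa.
  apply/imfsetP; exists b => /=; first by rewrite in_fset_set// inE.
  have [Afb rfb] : A (f b) /\ r (f b) b.
    exact: (@xgetPex _ a0 [set a | A a /\ r a b] (ex_intro _ a (conj Aa rab))).
  exact: rinj Bb rab rfb.
by rewrite (leq_trans le1)// leq_imfset_card.
Qed.

Fact one_block_partition (T : Type) (U : set T)
    (D := [set B : set T | B = U /\ B !=set0]) : partition D id (cover D id).
Proof. by split => // [B C [-> _] [-> _]|B []]. Qed.

(** The subpartition whose single block is the union of the underlying sets is an upper bound of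
    [F]. *)
Lemma underlying_join (T : Type) (F : set (subpart T)) : F !=set0 ->
  underlying (subpart_join F) `<=` \bigcup_(P in F) underlying P.
Proof.
move=> F0; set U := \bigcup_(P in F) _.
have leU : (subpart_join F <= Subpart (one_block_partition U))%O.
  apply: (subpart_joinP F0).2 => P FP; apply/subpart_leP => B PB.
  have BU : B `<=` U by move=> x Bx; exists P => //; exists B.
  have [x Bx] := block_neq0 PB.
  by exists U => //; split => //; exists x; exact: BU.
by move=> x /(subpart_le_underlying leU)[_ [-> _]].
Qed.

Lemma underlying_meet (T : Type) (F : set (subpart T)) : F !=set0 ->
  underlying (subpart_meet F) = \bigcap_(P in F) underlying P.
Proof.
move=> F0; apply/seteqP; split => [x mx P FP|x Ux].
  exact: (subpart_le_underlying ((subpart_meetP F0).1 _ FP) mx).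
(* The explicit infimum built from the classes [meet_class F x] lies below the meet, and such a
   class contains [x] as soon as every member of [F] covers [x]. *)
apply: (subpart_le_underlying ((subpart_meetP F0).2 _ (subpart_infimums F0).1)).
have xx : meet_class F x x by move=> P /Ux[B PB Bx]; exists B.
by exists (meet_class F x) => //; exists x.
Qed.

Lemma image_cint_neq0 (R : realType) (T : Type) (f : R -> T) (I : cint R) :
  f @` I !=set0.
Proof. by exists (f (lo I)); exists (lo I) => //; exact: cint_lo. Qed.

Section Pullback.
Variables (Z X : Type) (phi : {surj [set: Z] >-> [set: X]}).

Lemma surj_preimage (x : X) : exists z, phi z = x.
Proof. by have [z _ <-] : (phi @` setT) x by [exact: surj]; exists z. Qed.

Lemma pullback_subpart_le (P Q : subpart X) :
  (P <= Q)%O -> (pullback_subpart phi P <= pullback_subpart phi Q)%O.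
Proof.
move=> /subpart_leP PQ; apply/subpart_leP => _ [B /PQ[C QC BC] <-].
by exists (phi @^-1` C); [exists C|exact: preimage_subset].
Qed.

Lemma underlying_pullback (P : subpart X) :
  underlying (pullback_subpart phi P) = phi @^-1` underlying P.
Proof.
apply/seteqP; split => [z [_ [B PB <-] Bz]|z [B PB Bz]]; first by exists B.
by exists (phi @^-1` B) => //; exists B.
Qed.

(* Over a point covered by [F], each fibre lies in a single block of [Q], so the
   images of the blocks of [Q] again form a subpartition bounding [F]. *)
Lemma pullback_join_le (F : set (subpart X)) (Q : subpart Z) : F !=set0 ->
  (forall P, F P -> pullback_subpart phi P <= Q)%O ->
  (pullback_subpart phi (subpart_join F) <= Q)%O.
Proof.
move=> F0 FQ; pose U := \bigcup_(P in F) underlying P.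
have fibre D z z' : blocks Q D -> D z -> U (phi z) -> phi z' = phi z -> D z'.
  move=> QD Dz [P /FQ/subpart_leP PQ [B PB Bz]] z'z.
  have [E QE BE] := PQ _ (imageP _ PB).
  by rewrite (block_inj QD QE Dz (BE _ Bz)); apply: BE; rewrite /preimage/= z'z.
(* Intersecting with [U] keeps the images disjoint: outside [U] a fibre may meet several blocks of
   [Q]. *)
pose D := [set B | B !=set0 /\ exists2 E, blocks Q E & B = phi @` E `&` U].
have partD : partition D id (cover D id).
  split => // [_ _ [_ [B QB ->]] [_ [C QC ->]]|B []//].
  move=> [x [/= [[z Bz zx] Ux] [[w Cw wx] _]]].
  suff -> : B = C by [].
  apply: (block_inj QB QC Bz); apply: (fibre C w) => //; first by rewrite wx.
  by rewrite zx.
have /subpart_leP joinD : (subpart_join F <= Subpart partD)%O.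
  apply: (subpart_joinP F0).2 => P FP; apply/subpart_leP => B PB.
  have /subpart_leP/(_ _ (imageP _ PB))[E QE BE] := FQ _ FP.
  have BEU : B `<=` phi @` E `&` U.
    move=> x Bx; split; last by exists P => //; exists B.
    have [z zx] := surj_preimage x.
    by exists z => //; apply: BE; rewrite /preimage/= zx.
  exists (phi @` E `&` U) => //; split; last by exists E.
  by have [x /BEU] := block_neq0 PB; exists x.
apply/subpart_leP => _ [B /joinD[_ [_ [E QE ->]] BE] <-].
exists E => // z /BE[[w Ew wz] Uz].
by apply: (fibre E w) => //; rewrite wz.
Qed.

Lemma join_over_pullback (R : realType) (theta : R -> subpart X) (I : cint R) :
  join_over I (pullback phi theta) = pullback_subpart phi (join_over I theta).
Proof.
apply/eqP; rewrite eq_le; apply/andP; split.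
  apply: (subpart_joinP (image_cint_neq0 _ _)).2 => _ [t It <-].
  exact/pullback_subpart_le/le_join_over.
apply: pullback_join_le (image_cint_neq0 _ _) _ => _ [t It <-].
exact: (@le_join_over R Z (pullback phi theta)).
Qed.

End Pullback.

Section Formigrams.
Variable R : realType.

Lemma underlying_join_over (X : Type) (theta : R -> subpart X) (I : cint R) x :
  underlying (join_over I theta) x ->
  exists2 t, (I : set R) t & underlying (theta t) x.
Proof.
move=> jx; have [_ [t It <-] tx] := underlying_join (image_cint_neq0 _ _) jx.
by exists t.
Qed.

Lemma underlying_meet_over (X : Type) (theta : R -> subpart X) (I : cint R) x :
  underlying (meet_over I theta) x <->
  forall t, (I : set R) t -> underlying (theta t) x.
Proof.
rewrite /meet_over underlying_meet; last exact: image_cint_neq0.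
split=> [h t It|h _ [t It <-]]; last exact: h.
by apply: h; exists t.
Qed.

Lemma thicken_lo (I : cint R) (e : {nonneg R}) :
  (thicken I e : set R) (lo I - e%:num).
Proof. exact: cint_lo. Qed.

Lemma thicken_hi (I : cint R) (e : {nonneg R}) :
  (thicken I e : set R) (hi I + e%:num).
Proof. by rewrite /cint_set/= in_itv/= lexx thicken_subproof. Qed.

Section Interleaved.
Variables (X Y : finType) (Z : Type).
Variables (phiX : {surj [set: Z] >-> [set: X]}).
Variables (phiY : {surj [set: Z] >-> [set: Y]}).
Variables (thetaX : R -> subpart X) (thetaY : R -> subpart Y) (e : {nonneg R}).
Hypothesis itvY : forall y, is_interval (lifespan thetaY y).
Hypothesis leXY : forall I, (join_over I (pullback phiX thetaX) <=
  join_over (thicken I e) (pullback phiY thetaY))%O.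
Hypothesis leYX : forall I, (join_over I (pullback phiY thetaY) <=
  join_over (thicken I e) (pullback phiX thetaX))%O.

Lemma alive_interleaved z s : underlying (thetaX s) (phiX z) ->
  exists2 t, s - e%:num <= t <= s + e%:num & underlying (thetaY t) (phiY z).
Proof.
(* The interleaving is applied to the degenerate interval [[s, s]], whose thickening is
   [[s - e, s + e]]. *)
move=> sx; pose J := Cint (lexx s).
have Jx : underlying (join_over J thetaX) (phiX z).
  apply: subpart_le_underlying sx; apply: le_join_over.
  by rewrite /cint_set/= in_itv/= lexx.
have := subpart_le_underlying (leXY J).
rewrite !join_over_pullback !underlying_pullback => /(_ z Jx) Jy.
have [t] := underlying_join_over Jy.
by rewrite /cint_set/= in_itv/=; exists t.
Qed.

Lemma meet_interleaved I z :
  underlying (meet_over (thicken I e) thetaX) (phiX z) ->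
  underlying (meet_over I thetaY) (phiY z).
Proof.
move=> /underlying_meet_over mx; apply/underlying_meet_over => t.
rewrite /cint_set/= in_itv/= => /andP[It tI].
have [s /andP[_]] := alive_interleaved (mx _ (thicken_lo I e)).
rewrite subrK => sI sy.
have [s' /andP[+ _]] := alive_interleaved (mx _ (thicken_hi I e)).
rewrite addrK => Is' s'y.
apply: (itvY sy s'y).
by rewrite (le_trans sI It) (le_trans tI Is').
Qed.

Lemma cluster_count_interleaved I :
  (cluster_count thetaX (thicken I e) <= cluster_count thetaY I)%N.
Proof.
set X' := underlying (meet_over (thicken I e) thetaX).
(* Clusters are related when an apex point over [X'] maps into both. *)
pose r (D : set X) (A : set Y) :=
  exists2 z, X' (phiX z) & D (phiX z) /\ A (phiY z).
apply: (@card_fset_set_rel_le _ _ _ _ r); try exact: finite_set_of_sets.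
  move=> _ [C [JC [x [Cx X'x]]] <-].
  have [z zx] := surj_preimage phiX x; subst x.
  have Y'z := meet_interleaved X'x.
  have [B JB Bz] : underlying (join_over I thetaY) (phiY z).
    apply: subpart_le_underlying Y'z.
    exact: le_trans (ge_meet_over _ (cint_lo I)) (le_join_over _ (cint_lo I)).
  exists (B `&` underlying (meet_over I thetaY)); last by exists z.
  by exists B => //; split => //; exists (phiY z).
move=> _ _ _ [C [JC _] <-] [C' [JC' _] <-] [B [JB _] <-].
move=> [z _ [[Cz _] [Bz _]]] [z' _ [[C'z' _] [Bz' _]]].
(* The pullback of [B] lies in the pullback of a single block [E] of the join over [I^e]; both [C]
   and [C'] meet [E] there, hence equal it. *)
have := leYX I; rewrite !join_over_pullback.
move=> /subpart_leP/(_ _ (imageP _ JB))[_ [E JE <-] BE].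
by rewrite (block_inj JC JE Cz (BE _ Bz)) (block_inj JC' JE C'z' (BE _ Bz')).
Qed.

End Interleaved.

End Formigrams.

Theorem theorem6p35 (R : realType) (X Y : finType)
    (X_gt0 : (0 < #|X|)%N) (Y_gt0 : (0 < #|Y|)%N)
    (thetaX : R -> subpart X) (thetaY : R -> subpart Y)
    (formX : is_formigram thetaX) (formY : is_formigram thetaY)
    (suppX : bounded_set (fg_support thetaX))
    (suppY : bounded_set (fg_support thetaY))
    (critX : integer_critical_points thetaX)
    (critY : integer_critical_points thetaY) :
  (erosion_dist (cluster_count thetaX) (cluster_count thetaY)
     <= formigram_dist thetaX thetaY)%E.
Proof.
apply: le_ereal_inf_tmp => _ [e [[Z phiX phiY] /= tripod_e] <-].
(* As an infimum, [interleaving_dist] may be at most [e] without [e] being an interleaving. So the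
   two infima are compared through their witnesses: each interleaving parameter [d] is an erosion
   parameter. *)
apply: le_trans tripod_e; apply: ereal_inf_le_tmp => _ [d le_d <-].
exists d => // I.
split; apply: cluster_count_interleaved.
- by move=> y; have [] := formY.2 y.
- by move=> J; exact: (le_d J).1.
- by move=> J; exact: (le_d J).2.
- by move=> x; have [] := formX.2 x.
- by move=> J; exact: (le_d J).2.
- by move=> J; exact: (le_d J).1.
Qed.
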